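(* Let $f:\mathbb{R}^n\to\mathbb{R}$ be convex and differentiable with $L_f$-Lipschitz continuous gradient, let $f_1,\dots,f_m:\mathbb{R}^n\to\mathbb{R}$ be convex and continuously differentiable, each $\nabla f_i$ being $L_i$-Lipschitz continuous for a given $L_i\ge0$, and let $h:\mathbb{R}^n\to\mathbb{R}$ be convex and $L_h$-Lipschitz continuous. Assume that there exists $\bar x\in\mathbb{R}^n$ with $f_i(\bar x)<0$ for $i=1,\dots,m$, that the problem $$\min_{x\in\mathbb{R}^n}\ f(x)+h(x)\quad\text{s.t.}\quad f_i(x)\le0,\ i=1,\dots,m,$$ has a solution $x_*$, and that $L_i>0$ for some $i\in\{1,\dots,m\}$. Let $x_0$ be feasible for this problem and let $(x_k)_{k\in\mathbb{N}}$ be generated by $$x_{k+1}\in\underset{y\in\mathbb{R}^n}{\mathrm{argmin}}\ f(x_k)+\nabla f(x_k)^T(y-x_k)+\frac{L_f}{2}\|y-x_k\|^2+h(y)$$ $$\text{s.t.}\quad f_i(x_k)+\nabla f_i(x_k)^T(y-x_k)+\frac{L_i}{2}\|y-x_k\|^2\le0,\quad i=1,\dots,m,$$ with $x_{k+1}=x_k$ whenever $x_k$ is a solution of this subproblem. Then for any $k\ge1$, $x_k$ is feasible for the original problem and $$(f+h)(x_k)-(f+h)(x_* )\le\max\{1,\zeta\}\,\frac{\|\bm{L}\|(1+L_h)\|x_0-x_*\|^2}{2k},$$ where $\bm{L}=(L_f,L_1,\dots,L_m,0,\dots,0)^T\in\mathbb{R}^{n+m+1}$, $F(x)=(f(x),f_1(x),\dots,f_m(x),x)\in\mathbb{R}^{n+m+1}$,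 $\bar f=|\max_{i=1,\dots,m}f_i(\bar x)|$ and $$\zeta=8\|\bm{L}\|\left(\frac{\|\nabla F(x_0)\|_{\rm op}}{\|\bm{L}\|}+\frac12\big(11\|x_0-x_*\|+\|\bar x-x_*\|\big)\right)^2\frac{\bar f+\frac{\|\bm{L}\|}{2}\big(\|x_*-\bar x\|+\|x_*-x_0\|\big)^2}{\bar f^2}.$$
   Context: $\|\cdot\|$ is the Euclidean norm, $\|\cdot\|_{\rm op}$ the operator norm, and $\nabla F(x_0)$ the Jacobian matrix of $F$ at $x_0$. *)

(* Defs.v *)
(* Points of R^n are row vectors of type 'rV[R]_n. *)
From HB Require Import structures.
From mathcomp Require Import all_boot all_order all_algebra.
From mathcomp Require Import all_classical all_reals all_analysis.
Import Order.TTheory GRing.Theory Num.Theory.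
Import numFieldNormedType.Exports.

Set Implicit Arguments.
Unset Strict Implicit.
Unset Printing Implicit Defensive.

Local Open Scope classical_set_scope.
Local Open Scope ring_scope.

Section Euclidean.
Context {R : realType}.

Definition dotv n (u v : 'rV[R]_n) : R := \sum_(i < n) u 0 i * v 0 i.

(* The library norm on 'rV[R]_n is the maximum norm; it induces the same
   topology and the same notions of differentiability and of differential. *)
Definition enorm n (v : 'rV[R]_n) : R := Num.sqrt (dotv v v).

(* A acts on row vectors, v |-> v *m A, as the library's 'J F x does. *)
Definition opnorm n p (A : 'M[R]_(n, p)) : R :=
  sup [set enorm (v *m A) | v in [set v : 'rV[R]_n | enorm v <= 1]].

Definition elipschitz n p (L : R) (G : 'rV[R]_n -> 'rV[R]_p) : Prop :=
  forall x y, enorm (G x - G y) <= L * enorm (x - y).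

Definition elipschitzR n (L : R) (g : 'rV[R]_n -> R) : Prop :=
  forall x y, `|g x - g y| <= L * enorm (x - y).

Definition convexfun n (g : 'rV[R]_n -> R) : Prop :=
  @convex_function R 'rV[R]_n setT g.

Definition grad n (g : 'rV[R]_n -> R) (x : 'rV[R]_n) : 'rV[R]_n :=
  \row_(j < n) 'D_(delta_mx 0 j) g x.

End Euclidean.

Section Optimization.
Context {R : realType}.

Definition argmin T (C : set T) (phi : T -> R) : set T :=
  [set x | C x /\ forall y, C y -> phi x <= phi y].

Definition feasible n m (fs : 'I_m -> 'rV[R]_n -> R) : set 'rV[R]_n :=
  [set x | forall i, fs i x <= 0].

Definition quad_model n (g : 'rV[R]_n -> R) (L : R) (x y : 'rV[R]_n) : R :=
  g x + dotv (grad g x) (y - x) + L / 2 * enorm (y - x) ^+ 2.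

Definition subproblem_sol n m (f h : 'rV[R]_n -> R) (Lf : R)
    (fs : 'I_m -> 'rV[R]_n -> R) (Ls : 'I_m -> R) (x : 'rV[R]_n) :
    set 'rV[R]_n :=
  argmin (feasible (fun i => quad_model (fs i) (Ls i) x))
         (fun y => quad_model f Lf x y + h y).

Definition stackF n m (f : 'rV[R]_n -> R) (fs : 'I_m -> 'rV[R]_n -> R)
    (x : 'rV[R]_n) : 'rV[R]_(1 + m + n) :=
  row_mx (row_mx (f x)%:M (\row_(i < m) fs i x)) x.

Definition stackL n m (Lf : R) (Ls : 'I_m -> R) : 'rV[R]_(1 + m + n) :=
  row_mx (row_mx Lf%:M (\row_(i < m) Ls i)) 0.

Definition zeta n (normL normJ fbar : R) (x0 xstar xbar : 'rV[R]_n) : R :=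
  8 * normL *
  (normJ / normL + 1 / 2 * (11 * enorm (x0 - xstar) + enorm (xbar - xstar))) ^+ 2 *
  ((fbar + normL / 2 * (enorm (xstar - xbar) + enorm (xstar - x0)) ^+ 2) /
   fbar ^+ 2).

End Optimization.

(* Main.v *)
(* Lagrange multipliers lam of the subproblem at x_k make its Lagrangian strongly
   convex with modulus Lam = L_f + sum_i lam_i L_i and minimal at x_(k+1).
   Evaluating it at xstar gives
     (f+h)(x_(k+1)) - (f+h)(xstar) <= Lam / 2 * (|x_k - xstar|^2 - |x_(k+1) - xstar|^2),
   so the distances to xstar do not increase until optimality; since f+h decreases
   along the iterates, the estimates telescope once Lam is bounded uniformly.
   The bound on Lam comes from a point of [x_k, xbar] at which all constraint
   models are at most - fbar^2 / (4 A), A = fbar + |L| / 2 * (|xbar - xstar| +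
   |x_0 - xstar|)^2. It carries an additive L_f, absorbed because zeta >= 8
   as soon as one constraint is active with nonzero multiplier. *)
Require Import Defs.
From HB Require Import structures.
From mathcomp Require Import all_boot all_order all_algebra.
From mathcomp Require Import all_classical all_reals all_analysis.
From mathcomp Require Import ring lra.
Import Order.TTheory GRing.Theory Num.Theory.
Import numFieldNormedType.Exports.

Set Implicit Arguments.
Unset Strict Implicit.
Unset Printing Implicit Defensive.

Local Open Scope classical_set_scope.
Local Open Scope ring_scope.

(** * Euclidean inner product and norm on row vectors *)

Section EuclideanNorm.
Context {R : realType} {n : nat}.
Implicit Types (u v w : 'rV[R]_n) (a : R).

Lemma dotvC u v : dotv u v = dotv v u.
Proof. by apply: eq_bigr => i _; rewrite mulrC. Qed.

Lemma dotvDl u v w : dotv (u + v) w = dotv u w + dotv v w.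
Proof. by rewrite -big_split; apply: eq_bigr => i _; rewrite !mxE mulrDl. Qed.

Lemma dotvZl a u v : dotv (a *: u) v = a * dotv u v.
Proof. by rewrite mulr_sumr; apply: eq_bigr => i _; rewrite !mxE mulrA. Qed.

Lemma dotvDr u v w : dotv u (v + w) = dotv u v + dotv u w.
Proof. by rewrite dotvC dotvDl !(dotvC _ u). Qed.

Lemma dotvZr a u v : dotv u (a *: v) = a * dotv u v.
Proof. by rewrite dotvC dotvZl dotvC. Qed.

Lemma dotvNl u v : dotv (- u) v = - dotv u v.
Proof. by rewrite -scaleN1r dotvZl mulN1r. Qed.

Lemma dotvNr u v : dotv u (- v) = - dotv u v.
Proof. by rewrite -scaleN1r dotvZr mulN1r. Qed.

Definition dotvE := (dotvDl, dotvDr, dotvZl, dotvZr, dotvNl, dotvNr).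

Lemma dotvv_ge0 u : 0 <= dotv u u.
Proof. by apply: sumr_ge0 => i _; rewrite -expr2 sqr_ge0. Qed.

Lemma enorm_ge0 u : 0 <= enorm u.
Proof. exact: sqrtr_ge0. Qed.

Lemma enorm_sqr u : enorm u ^+ 2 = dotv u u.
Proof. by rewrite sqr_sqrtr ?dotvv_ge0. Qed.

Lemma enorm_le u a : 0 <= a -> (enorm u <= a) = (dotv u u <= a ^+ 2).
Proof. by move=> a0; rewrite -enorm_sqr ler_sqr ?nnegrE ?enorm_ge0. Qed.

Lemma enormZ a u : enorm (a *: u) = `|a| * enorm u.
Proof.
by rewrite /enorm dotvZl dotvZr mulrA -expr2 sqrtrM ?sqr_ge0// sqrtr_sqr.
Qed.

Lemma enorm0 : enorm (0 : 'rV[R]_n) = 0.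
Proof. by rewrite -(scale0r 0) enormZ normr0 mul0r. Qed.

Lemma enormN u : enorm (- u) = enorm u.
Proof. by rewrite -scaleN1r enormZ normrN1 mul1r. Qed.

Lemma enormBC u v : enorm (u - v) = enorm (v - u).
Proof. by rewrite -enormN opprB. Qed.

Lemma coord_le_enorm u i : `|u 0 i| <= enorm u.
Proof.
rewrite -ler_sqr ?nnegrE ?enorm_ge0// enorm_sqr real_normK ?num_real//.
rewrite /dotv (bigD1 i)//= -expr2 lerDl.
by apply: sumr_ge0 => j _; rewrite -expr2 sqr_ge0.
Qed.

Lemma enorm_eq0 u : enorm u = 0 -> u = 0.
Proof.
move=> u0; apply/rowP => i; rewrite mxE; apply/eqP.
by rewrite -normr_le0 -u0 coord_le_enorm.
Qed.

(** Cauchy-Schwarz: expand the square of [enorm v *: u - enorm u *: v] and cancel the product of the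
    norms when it is nonzero. *)
Lemma dotv_le u v : dotv u v <= enorm u * enorm v.
Proof.
have [u0|u0] := eqVneq (enorm u) 0.
  by rewrite u0 mul0r (enorm_eq0 u0) /dotv big1// => i _; rewrite mxE mul0r.
have [v0|v0] := eqVneq (enorm v) 0.
  by rewrite v0 mulr0 (enorm_eq0 v0) /dotv big1// => i _; rewrite mxE mulr0.
have ugt0 : 0 < enorm u by rewrite lt_def u0 enorm_ge0.
have vgt0 : 0 < enorm v by rewrite lt_def v0 enorm_ge0.
have := dotvv_ge0 (enorm v *: u - enorm u *: v).
rewrite !dotvE -!enorm_sqr (dotvC v u) => h.
have : 0 <= (enorm u * enorm v) * (enorm u * enorm v - dotv u v) by lra.
by rewrite pmulr_rge0 ?mulr_gt0// subr_ge0.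
Qed.

Lemma enormD u v : enorm (u + v) <= enorm u + enorm v.
Proof.
rewrite enorm_le ?addr_ge0 ?enorm_ge0// !dotvE -!enorm_sqr (dotvC v u).
have := dotv_le u v; lra.
Qed.

Lemma enormB_le u v w : enorm (u - w) <= enorm (u - v) + enorm (v - w).
Proof. by apply: le_trans (enormD _ _); rewrite addrA subrK. Qed.

End EuclideanNorm.

(** * Strong convexity and growth away from a minimiser *)

Section StrongConvexity.
Context {R : realType} {n : nat}.
Implicit Types (g : 'rV[R]_n -> R) (x y : 'rV[R]_n).

(** Modulus 0 is plain convexity, so one calculus covers both the convex data and the strongly
    convex Lagrangian. *)
Definition strongly_convex (mu : R) g := forall (t : R) x y, 0 <= t <= 1 ->
  g (t *: x + (1 - t) *: y) <=
    t * g x + (1 - t) * g y - mu / 2 * (t * (1 - t)) * enorm (x - y) ^+ 2.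

Lemma strongly_convex0 g : convexfun g -> strongly_convex 0 g.
Proof.
move=> cg t x y t01; rewrite !mul0r subr0.
by have := cg (Itv01 (andP t01).1 (andP t01).2) x y (mem_set I) (mem_set I).
Qed.

Lemma strongly_convexW mu nu g :
  nu <= mu -> strongly_convex mu g -> strongly_convex nu g.
Proof.
move=> le_nu cg t x y t01; apply: le_trans (cg t x y t01) _.
rewrite lerD2l lerN2 ler_wpM2r ?sqr_ge0// ler_wpM2r ?ler_wpM2r ?invr_ge0//.
by case/andP: t01 => t0 t1; rewrite mulr_ge0// subr_ge0.
Qed.

Lemma strongly_convexD mu nu g1 g2 : strongly_convex mu g1 ->
  strongly_convex nu g2 -> strongly_convex (mu + nu) (fun x => g1 x + g2 x).
Proof.
move=> c1 c2 t x y t01; have := lerD (c1 t x y t01) (c2 t x y t01); lra.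
Qed.

Lemma strongly_convexZ mu a g : 0 <= a ->
  strongly_convex mu g -> strongly_convex (a * mu) (fun x => a * g x).
Proof.
move=> a0 cg t x y t01; have := ler_wpM2l a0 (cg t x y t01); lra.
Qed.

Lemma strongly_convex_sum (I : finType) (mu : I -> R)
    (g : I -> 'rV[R]_n -> R) : (forall i, strongly_convex (mu i) (g i)) ->
  strongly_convex (\sum_i mu i) (fun x => \sum_i g i x).
Proof.
move=> cg t x y t01.
rewrite !mulr_suml !mulr_sumr -big_split -sumrB /=.
by apply: ler_sum => i _; apply: cg.
Qed.

Lemma enorm_comb (t : R) x y z :
  enorm (t *: x + (1 - t) *: y - z) ^+ 2 =
    t * enorm (x - z) ^+ 2 + (1 - t) * enorm (y - z) ^+ 2
    - t * (1 - t) * enorm (x - y) ^+ 2.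
Proof.
rewrite !enorm_sqr !dotvE (dotvC y x) (dotvC z x) (dotvC z y); ring.
Qed.

(** Apart from [mu / 2] times the squared distance to [z], the model is affine in its last argument;
    by [enorm_comb] the inequality is an equality. *)
Lemma strongly_convex_quad_model g mu z : strongly_convex mu (quad_model g mu z).
Proof.
move=> t x y _; rewrite /quad_model enorm_comb !dotvE.
by lra.
Qed.

(* Let the convex combination tend to the minimiser. *)
Lemma strongly_convex_min mu g x y : strongly_convex mu g ->
  (forall z, g x <= g z) -> g x + mu / 2 * enorm (y - x) ^+ 2 <= g y.
Proof.
move=> cg xmin; set q := mu / 2 * _.
have key (t : R) : 0 < t -> t <= 1 -> g x + q <= g y + t * q.
  move=> t0 t1; have t01 : 0 <= t <= 1 by rewrite ltW.
  have := le_trans (xmin _) (cg t y x t01) => h.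
  have : 0 <= t * (g y - g x - (1 - t) * q) by rewrite /q; lra.
  by rewrite pmulr_rge0// => ?; lra.
apply/ler_addgt0Pr => e e0.
(* With t = e / (|q| + e) the error t * q is at most e, and t stays in ]0, 1]. *)
have d0 : 0 < `|q| + e by rewrite ltr_wpDl.
have t1 : e / (`|q| + e) <= 1 by rewrite ler_pdivrMr// mul1r lerDr.
have t0 : 0 < e / (`|q| + e) by rewrite divr_gt0.
apply: le_trans (key _ t0 t1) _; rewrite lerD2l.
apply: (@le_trans _ _ (e / (`|q| + e) * `|q|)).
  by rewrite ler_wpM2l ?ler_norm// ltW.
rewrite mulrAC ler_pdivrMr// ler_pM2l// lerDl; exact: ltW.
Qed.

End StrongConvexity.

(** * Lagrange multipliers under a Slater condition *)

Section LagrangeDuality.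
Context {R : realType} {n : nat}.
Implicit Types (g phi psi : 'rV[R]_n -> R) (C : set 'rV[R]_n).

(* The multiplier is the supremum of the slopes over the points violating the
   constraint; a Slater point bounds these slopes. *)
Lemma lagrange_one C phi psi p z0 :
  (forall t x y, 0 <= t <= 1 -> C x -> C y -> C (t *: x + (1 - t) *: y)) ->
  strongly_convex 0 phi -> strongly_convex 0 psi ->
  C z0 -> psi z0 < 0 ->
  (forall y, C y -> psi y <= 0 -> p <= phi y) ->
  exists2 l, 0 <= l & forall y, C y -> p <= phi y + l * psi y.
Proof.
move=> cC cphi cpsi Cz0 z0lt0 pP.
(* The element 0 keeps the set nonempty even if no point of [C] violates the constraint, and makes
   the supremum nonnegative. *)
pose S := [set a : R | a = 0 \/
  exists y, [/\ C y, 0 < psi y & a = (p - phi y) / psi y]].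
(* Used at [z0] to make the supremum finite, and later at each strictly feasible [y] to get the
   inequality there. *)
have ubS z : C z -> psi z < 0 -> ubound S ((phi z - p) / - psi z).
  move=> Cz zlt0 _ [->|[y [Cy ygt0 ->]]].
    by rewrite divr_ge0 ?subr_ge0 ?pP ?oppr_ge0 ?ltW.
  rewrite ler_pdivrMr// mulrAC ler_pdivlMr ?oppr_gt0//.
  set d := psi y - psi z.
  have d0 : 0 < d by rewrite /d; lra.
  (* With this weight the chord of [psi] between [y] and [z] vanishes, so by convexity the
     combination satisfies the constraint and [pP] applies to it. *)
  pose t := - psi z / d.
  have td : t * d = - psi z by rewrite /t mulfVK// gt_eqF.
  have td' : (1 - t) * d = psi y by rewrite mulrBl td /d; ring.
  have t01 : 0 <= t <= 1.
    rewrite /t divr_ge0 ?ler_pdivrMr//= ?mul1r ?oppr_ge0 ?(ltW zlt0) ?(ltW d0)//.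
    by rewrite /d; lra.
  have := cpsi t y z t01; have := cphi t y z t01; rewrite !mul0r !subr0.
  have -> : t * psi y + (1 - t) * psi z = 0.
    apply: (mulIf (lt0r_neq0 d0)).
    rewrite mul0r mulrDl mulrAC td (mulrAC (1 - t)) td'; ring.
  move=> h1 h2; have := le_trans (pP _ (cC _ _ _ t01 Cy Cz) h2) h1 => h.
  have := ler_wpM2r (ltW d0) h.
  rewrite mulrDl mulrAC td (mulrAC (1 - t)) td' /d; lra.
have supS : has_sup S.
  by split; [exists 0; left | exists ((phi z0 - p) / - psi z0); exact: ubS].
exists (sup S); first by apply: (ub_le_sup supS.2); left.
move=> y Cy; have [ygt0|ylt0|y0] := ltgtP 0 (psi y).
- have : (p - phi y) / psi y <= sup S.
    by apply: (ub_le_sup supS.2); right; exists y.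
  by rewrite ler_pdivrMr//; lra.
- have : sup S <= (phi y - p) / - psi y by apply: (ge_sup supS.1); exact: ubS.
  by rewrite ler_pdivlMr ?oppr_gt0//; lra.
- by rewrite -y0 mulr0 addr0 pP// -y0.
Qed.

(** Induction: dualise the first constraint over the convex set cut out by the others, then move its
    term into the objective. *)
Lemma lagrange_seq (I : eqType) (s : seq I) (psi : I -> 'rV[R]_n -> R)
    phi p z0 : uniq s ->
  strongly_convex 0 phi -> (forall i, strongly_convex 0 (psi i)) ->
  (forall i, psi i z0 < 0) ->
  (forall y, (forall i, i \in s -> psi i y <= 0) -> p <= phi y) ->
  exists2 l : I -> R, (forall i, 0 <= l i) &
    forall y, p <= phi y + \sum_(i <- s) l i * psi i y.
Proof.
elim: s phi => [|i s IH] phi /=.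
  move=> _ _ _ _ pP; exists (fun=> 0) => // y.
  by rewrite big_nil addr0 pP.
move=> /andP[iNs us] cphi cpsi slater pP.
pose C := [set y | forall j, j \in s -> psi j y <= 0].
have [||||mu mu0 muP] := @lagrange_one C phi (psi i) p z0 _ cphi (cpsi i).
- move=> t x y t01 Cx Cy j js; have /andP[t0 t1] := t01.
  apply: le_trans (cpsi j t x y t01) _; rewrite !mul0r subr0.
  have := Cx j js; have := Cy j js.
  have : 0 <= 1 - t by lra.
  nra.
- by move=> j _; rewrite ltW.
- exact: slater.
- move=> y Cy yi; apply: pP => j; rewrite inE => /orP[/eqP->//|]; exact: Cy.
have [||l l0 lP] := IH (fun y => phi y + mu * psi i y) us _ cpsi slater.
- rewrite -[0]addr0 -[X in _ + X](mulr0 mu).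
  by apply: strongly_convexD => //; exact: strongly_convexZ.
- exact: muP.
(* As [i] does not occur in [s], giving it the value [mu] leaves the remaining sum unchanged. *)
exists (fun j => if j == i then mu else l j) => [j|y]; first by case: ifP.
rewrite big_cons eqxx addrA; apply: le_trans (lP y) _.
rewrite lerD2l le_eqVlt; apply/orP; left; apply/eqP.
apply: eq_big_seq => j js; case: eqP => // ji.
by rewrite -ji js in iNs.
Qed.

End LagrangeDuality.

(** * Gradients: tangent and quadratic bounds *)

Section Gradient.
Context {R : realType} {n : nat}.
Implicit Types (g : 'rV[R]_n -> R) (x y v : 'rV[R]_n).

Lemma derive_grad g x v : differentiable g x -> 'D_v g x = dotv (grad g x) v.
Proof.
move=> dg; rewrite deriveE// {1}(row_sum_delta v) linear_sum.
by apply: eq_bigr => j _; rewrite linearZ mxE deriveE//= mulrC.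
Qed.

(** By convexity the difference quotients along [y - x] with step in ]0, 1] are at most [g y - g x];
    the derivative is their limit from the right. *)
Lemma convexfun_grad g x y : convexfun g -> differentiable g x ->
  g x + dotv (grad g x) (y - x) <= g y.
Proof.
move=> cg dg; rewrite -lerBrDl -derive_grad//.
have dv : derivable g x (y - x) by exact: diff_derivable.
rewrite ['D_(y - x) g x]cvg_at_rightE; last exact: dv.
apply: limr_le.
  by apply/cvg_ex; eexists; exact: (cvg_dnbhs_at_right dv).
near=> t.
have t0 : 0 < t by near: t; exact: nbhs_right_gt.
have t1 : t <= 1 by near: t; exact: nbhs_right_le.
rewrite /= -[_ *: _]/(t^-1 * _) ler_pdivrMl//.
have := strongly_convex0 cg y x (t := t).
rewrite !mul0r subr0 (ltW t0) t1 => /(_ isT).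
rewrite (_ : t *: (y - x) + x = t *: y + (1 - t) *: x); first by lra.
by apply/rowP => i; rewrite !mxE; ring.
Unshelve. all: by end_near. Qed.

(* Halving the segment turns the constant C into C / 2 + L / 4, whose fixed
   point is L / 2. *)
Lemma quad_model_ge g L x y : convexfun g -> (forall z, differentiable g z) ->
  0 <= L -> elipschitz L (grad g) -> g y <= quad_model g L x y.
Proof.
move=> cg dg L0 lipg.
have lip u v w a : 0 <= a -> w = a *: (v - u) ->
    dotv (grad g v) w <= dotv (grad g u) w + L * a * enorm (v - u) ^+ 2.
  move=> a0 ->; rewrite -lerBlDl -dotvNl -dotvDl.
  apply: le_trans (dotv_le _ _) _; rewrite enormZ ger0_norm//.
  apply: (@le_trans _ _ (L * enorm (v - u) * (a * enorm (v - u)))); last by lra.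
  by rewrite ler_wpM2r ?mulr_ge0 ?enorm_ge0.
have bound k : forall u v, g v <= g u + dotv (grad g u) (v - u) +
    (L / 2 + L / 2 / 2 ^+ k) * enorm (v - u) ^+ 2.
  elim: k => [|k IH] u v.
    (* Initial constant [L]: the tangent inequality at [v], with the gradient at [v] then exchanged
       for the one at [u]. *)
    have := convexfun_grad u cg (dg v); rewrite -opprB dotvNr => h.
    have := lip u v (v - u) 1 ler01 (esym (scale1r _)); rewrite expr0; lra.
  (* The bounds on both halves are added; exchanging the gradient at the midpoint for the one at [u]
     costs [L / 4] times the squared length. *)
  pose w := 2^-1 *: (u + v).
  have vw : v - w = 2^-1 *: (v - u) by apply/rowP => i; rewrite !mxE; lra.
  have wu : w - u = 2^-1 *: (v - u) by apply/rowP => i; rewrite !mxE; lra.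
  have := IH u w; have := IH w v; rewrite vw.
  have := lip u w (v - w) 1 ler01; rewrite vw scale1r => /(_ (esym wu)).
  rewrite wu !dotvZr !enormZ ger0_norm ?invr_ge0// (exprS _ k) invfM.
  set a := (2 ^+ k)^-1; lra.
rewrite /quad_model; set q := g x + _; set d := enorm _ ^+ 2.
apply/ler_addgt0Pr => e e0; have d0 : 0 <= d by exact: sqr_ge0.
(* Since [2 ^+ k] exceeds [k], this [k] brings the excess term down to at most [e]. *)
have [k ke] : exists k : nat, L / 2 * d / e < k%:R.
  exists (Num.bound (L / 2 * d / e)); apply: archi_boundP.
  by apply: divr_ge0 (ltW e0); apply: mulr_ge0 => //; lra.
have ek : L / 2 / 2 ^+ k * d <= e.
  rewrite mulrAC ler_pdivrMr ?exprn_gt0// [e * _]mulrC -ler_pdivrMr//.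
  by apply: (le_trans (ltW ke)); rewrite -natrX ler_nat; exact/ltnW/ltn_expl.
have := bound k x y; rewrite -/q -/d; lra.
Qed.

Lemma quad_model_le g L x y : convexfun g -> differentiable g x ->
  quad_model g L x y <= g y + L / 2 * enorm (y - x) ^+ 2.
Proof. by move=> cg dg; rewrite lerD2r convexfun_grad. Qed.

End Gradient.

(** * Operator norm of a Jacobian and gradients of coordinates *)

Section OperatorNorm.
Context {R : realType} {n p : nat}.

Lemma enorm_sum (I : Type) (s : seq I) (u : I -> 'rV[R]_p) :
  enorm (\sum_(i <- s) u i) <= \sum_(i <- s) enorm (u i).
Proof.
elim/big_rec2: _ => [|i a u' _ h]; last exact: le_trans (enormD _ _) (lerD _ _).
by rewrite -(scale0r 0) enormZ normr0 mul0r.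
Qed.

(** A [sup] bounds its set only when that set is bounded above; the sum of the row norms is a bound
    here, because coordinates in the unit ball are at most 1 in absolute value. *)
Lemma opnorm_ge (A : 'M[R]_(n, p)) (v : 'rV[R]_n) :
  enorm v <= 1 -> enorm (v *m A) <= opnorm A.
Proof.
move=> v1; apply: sup_upper_bound; last by exists v.
split; first by exists (enorm (v *m A)); exists v.
exists (\sum_i enorm (row i A)) => _ [w w1 <-].
rewrite mulmx_sum_row; apply: le_trans (enorm_sum _ _) _.
apply: ler_sum => i _; rewrite enormZ ler_piMl ?enorm_ge0//.
exact: le_trans (coord_le_enorm _ _) w1.
Qed.

Lemma derive_coord_le_opnorm (F : 'rV[R]_n -> 'rV[R]_p) x v j :
  differentiable F x -> enorm v <= 1 ->
  `|'D_v (fun y => F y 0 j) x| <= opnorm ('J F x).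
Proof.
move=> dF v1; apply: le_trans (opnorm_ge _ v1).
apply: le_trans (coord_le_enorm _ j).
by rewrite -deriveEjacobian// derive_mx ?mxE//; exact: diff_derivable.
Qed.

(** In the direction of the normalised gradient the derivative equals the norm of the gradient; a
    zero gradient is treated apart. *)
Lemma grad_coord_le_opnorm (F : 'rV[R]_n -> 'rV[R]_p) x j :
  differentiable F x -> enorm (grad (fun y => F y 0 j) x) <= opnorm ('J F x).
Proof.
move=> dF; set g := grad _ x.
have dFj : differentiable (fun y => F y 0 j) x.
  exact: (differentiable_comp dF (differentiable_coord _ _ _)).
have [g0|g0] := eqVneq (enorm g) 0.
  rewrite g0 (le_trans _ (@opnorm_ge _ 0 _)) ?enorm_ge0//.
  by rewrite enorm0 ler01.
have g1 : enorm ((enorm g)^-1 *: g) <= 1.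
  by rewrite enormZ ger0_norm ?invr_ge0 ?enorm_ge0// mulVf.
have := @derive_coord_le_opnorm F x _ j dF g1.
rewrite derive_grad// dotvZr -/g -enorm_sqr expr2 mulKf//.
by rewrite ger0_norm ?enorm_ge0.
Qed.

End OperatorNorm.

(** * The stacked map and the stacked Lipschitz constants *)

Section Stack.
Context {R : realType} {n m : nat}.
Context (f : 'rV[R]_n -> R) (fs : 'I_m -> 'rV[R]_n -> R).
Implicit Type x : 'rV[R]_n.

Lemma stackF_obj y : stackF f fs y 0 (lshift n (lshift m 0)) = f y.
Proof. by rewrite /stackF !row_mxEl mxE. Qed.

Lemma stackF_constr y i : stackF f fs y 0 (lshift n (rshift 1 i)) = fs i y.
Proof. by rewrite /stackF row_mxEl row_mxEr mxE. Qed.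

Lemma stackF_id y j : stackF f fs y 0 (rshift (1 + m) j) = y 0 j.
Proof. by rewrite /stackF row_mxEr. Qed.

Lemma differentiable_stackF x : differentiable f x ->
  (forall i, differentiable (fs i) x) -> differentiable (stackF f fs) x.
Proof.
move=> df dfs.
have -> : stackF f fs =
    \sum_j (fun y => stackF f fs y 0 j *: delta_mx 0 j).
  by apply/funext => y; rewrite fct_sumE -row_sum_delta.
apply: differentiable_sum => j; apply: differentiableZl.
case: (split_ordP j) => [a|b] ->.
- case: (split_ordP a) => [c|c] ->.
    by rewrite ord1; under eq_fun do rewrite stackF_obj.
  by under eq_fun do rewrite stackF_constr.
- under eq_fun do rewrite stackF_id.
  exact: differentiable_coord.
Qed.

(** The last block of the map is the identity, with derivative 1 along a unit coordinate vector.
    This bound later lets [multiplier_arith] absorb [Lh]. *)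
Lemma opnorm_stackF_ge1 x : (0 < n)%N -> differentiable (stackF f fs) x ->
  1 <= opnorm ('J (stackF f fs) x).
Proof.
move=> n0 dF; pose j := Ordinal n0.
have d1 : enorm (delta_mx 0 j : 'rV[R]_n) <= 1.
  rewrite enorm_le// /dotv (bigD1 j)//= big1 => [|i /negPf ij].
    by rewrite !mxE !eqxx mulr1 addr0 expr1n.
  by rewrite !mxE ij mul0r.
apply: le_trans (derive_coord_le_opnorm (rshift _ j) dF d1).
under eq_fun do rewrite stackF_id.
have -> : 'D_(delta_mx 0 j) (fun y : 'rV[R]_n => y 0 j) x = 1.
  have did : derivable (id : 'rV[R]_n -> 'rV[R]_n) x (delta_mx 0 j).
    exact: derivable_id.
  have := derive_mx did; rewrite derive_id => /matrixP/(_ 0 j).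
  by rewrite !mxE !eqxx => <-.
by rewrite normr1.
Qed.

Lemma coord_le_enorm_stackL (Lf : R) (Ls : 'I_m -> R) :
  `|Lf| <= enorm (stackL n Lf Ls) /\ forall i, `|Ls i| <= enorm (stackL n Lf Ls).
Proof.
split=> [|i].
  have := coord_le_enorm (stackL n Lf Ls) (lshift n (lshift m 0)).
  by rewrite /stackL !row_mxEl mxE.
have := coord_le_enorm (stackL n Lf Ls) (lshift n (rshift 1 i)).
by rewrite /stackL row_mxEl row_mxEr mxE.
Qed.

End Stack.

(** * Duality and Slater estimates for one subproblem *)

Section Subproblem.
Context {R : realType} {n m : nat}.
Implicit Types (f g h : 'rV[R]_n -> R) (fs : 'I_m -> 'rV[R]_n -> R).
Implicit Types (x y z : 'rV[R]_n) (Lf L N J D E b : R) (Ls lam : 'I_m -> R).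

(** At [xp] the dual inequality and feasibility force complementary slackness. Hence [xp] minimises
    the Lagrangian, and [strongly_convex_min] gives the quadratic growth. *)
Lemma subproblem_multipliers f h fs Lf Ls x xp y0 :
  0 <= Lf -> (forall i, 0 <= Ls i) -> convexfun h ->
  (forall i, quad_model (fs i) (Ls i) x y0 < 0) ->
  subproblem_sol f h Lf fs Ls x xp ->
  exists lam, [/\ forall i, 0 <= lam i,
    forall i, lam i * quad_model (fs i) (Ls i) x xp = 0 &
    forall y, quad_model f Lf x xp + h xp +
        (Lf + \sum_i lam i * Ls i) / 2 * enorm (y - xp) ^+ 2 <=
      quad_model f Lf x y + h y +
        \sum_i lam i * quad_model (fs i) (Ls i) x y].
Proof.
move=> Lf0 Ls0 ch slater [xpf xpmin].
have cobj : strongly_convex Lf (fun y => quad_model f Lf x y + h y).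
  rewrite -[Lf]addr0; apply: strongly_convexD; last exact: strongly_convex0.
  by rewrite addr0; exact: strongly_convex_quad_model.
have cq i := @strongly_convex_quad_model R n (fs i) (Ls i) x.
have [||||l l0 lP] := @lagrange_seq R n _ (index_enum 'I_m)
  (fun i => quad_model (fs i) (Ls i) x) (fun y => quad_model f Lf x y + h y)
  (quad_model f Lf x xp + h xp) y0 (index_enum_uniq _).
- exact: strongly_convexW cobj.
- by move=> i; exact: strongly_convexW (cq i).
- exact: slater.
- by move=> y yf; apply: xpmin => i; apply: yf; exact: mem_index_enum.
have slack i : l i * quad_model (fs i) (Ls i) x xp <= 0.
  by rewrite mulr_ge0_le0// xpf.
have sum0 : \sum_i l i * quad_model (fs i) (Ls i) x xp = 0.
  apply/eqP; rewrite eq_le sumr_le0//=; have := lP xp; lra.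
exists l; split => // [i|y].
  apply/eqP; rewrite eq_le slack//=.
  rewrite -sum0 (bigD1 i)//= gerDl; exact: sumr_le0.
have cl : strongly_convex (Lf + \sum_i l i * Ls i) (fun y =>
    quad_model f Lf x y + h y + \sum_i l i * quad_model (fs i) (Ls i) x y).
  apply: strongly_convexD => //; apply: strongly_convex_sum => i.
  exact: strongly_convexZ.
have := strongly_convex_min (x := xp) y cl; rewrite /= sum0 addr0; apply.
by move=> z; exact: lP.
Qed.

(** The growth inequality is read at [z]. At [xp] the model of [f] majorises [f]; at [z] each model
    exceeds its function by at most half its constant times the squared distance to [x]. *)
Lemma subproblem_decrease f h fs Lf Ls lam x xp z :
  convexfun f -> (forall y, differentiable f y) -> 0 <= Lf ->
  elipschitz Lf (grad f) ->
  (forall i, convexfun (fs i)) -> (forall i y, differentiable (fs i) y) ->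
  (forall i, 0 <= lam i) ->
  (forall y, quad_model f Lf x xp + h xp +
        (Lf + \sum_i lam i * Ls i) / 2 * enorm (y - xp) ^+ 2 <=
      quad_model f Lf x y + h y +
        \sum_i lam i * quad_model (fs i) (Ls i) x y) ->
  feasible fs z ->
  f xp + h xp - (f z + h z) <= (Lf + \sum_i lam i * Ls i) / 2 *
    (enorm (x - z) ^+ 2 - enorm (xp - z) ^+ 2).
Proof.
move=> cf df Lf0 lf cfs dfs lam0 /(_ z) h1 zf.
have h2 := quad_model_ge x xp cf df Lf0 lf.
have h3 := @quad_model_le R n f Lf x z cf (df x).
have h4 : \sum_i lam i * quad_model (fs i) (Ls i) x z <=
    (\sum_i lam i * Ls i) / 2 * enorm (z - x) ^+ 2.
  rewrite -mulrA mulr_suml; apply: ler_sum => i _.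
  rewrite -[leRHS]mulrA ler_wpM2l//.
  apply: le_trans (quad_model_le _ _ (cfs i) (dfs i x)) _.
  by rewrite mulrA gerDr zf.
rewrite (enormBC x) (enormBC xp); lra.
Qed.

(** At the fraction t of the segment from [x] to [xbar] the model is at most -t * b + t^2 * A, which
    t = b / (2 * A) minimises. *)
Lemma quad_model_slater g L N x xbar b W A : A = b + N / 2 * W ^+ 2 ->
  convexfun g -> differentiable g x -> 0 <= L -> L <= N -> 0 < b ->
  g x <= 0 -> g xbar <= - b -> enorm (xbar - x) <= W ->
  quad_model g L x (x + b / (2 * A) *: (xbar - x)) <= - (b ^+ 2 / (4 * A)).
Proof.
move=> defA cg dg L0 LN b0 gx gb xW.
have N0 : 0 <= N by exact: le_trans LN.
have A0 : 0 < A by rewrite defA ltr_wpDr// mulr_ge0 ?divr_ge0 ?sqr_ge0.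
have bA : b <= A by rewrite defA lerDl mulr_ge0 ?divr_ge0 ?sqr_ge0.
set t := b / (2 * A).
have tA : t * A = b / 2 by rewrite /t; field; exact: lt0r_neq0.
have t0 : 0 <= t by rewrite divr_ge0 ?mulr_ge0 ?ltW.
have t1 : t <= 1 by rewrite ler_pdivrMr ?mulr_gt0//; lra.
have -> : b ^+ 2 / (4 * A) = t * (b / 2).
  by rewrite /t; field; exact: lt0r_neq0.
rewrite /quad_model (addrC x) addrK dotvZr enormZ ger0_norm// exprMn.
have h1 := ler_wpM2l t0 (convexfun_grad xbar cg dg).
have h2 : L / 2 * enorm (xbar - x) ^+ 2 <= N / 2 * W ^+ 2.
  apply: ler_pM; rewrite ?sqr_ge0//; [lra|lra|].
  by rewrite ler_sqr ?nnegrE ?enorm_ge0// (le_trans _ xW) ?enorm_ge0.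
have h3 := ler_wpM2l (sqr_ge0 t) h2.
have h4 : t ^+ 2 * (N / 2 * W ^+ 2) = t * (b / 2) - t ^+ 2 * b.
  by rewrite -tA defA; ring.
have h5 : t * g xbar <= t * - b by rewrite ler_wpM2l.
have h6 : (1 - t) * g x <= 0 by rewrite mulr_ge0_le0// subr_ge0.
have h7 : 0 <= t ^+ 2 * b by rewrite mulr_ge0 ?sqr_ge0 ?ltW.
lra.
Qed.

(** The tangent inequality at [xbar], with [g x] eliminated through the active model, then
    Cauchy-Schwarz. An active constraint thus limits the Slater margin by distances. *)
Lemma active_slater_bound g L x xp xbar :
  convexfun g -> differentiable g x -> quad_model g L x xp = 0 ->
  - g xbar <= enorm (grad g x) * enorm (xp - xbar) +
    L / 2 * enorm (xp - x) ^+ 2.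
Proof.
move=> cg dg; rewrite /quad_model => q0.
have h1 := convexfun_grad xbar cg dg.
have h2 := dotv_le (grad g x) (xp - xbar).
have h3 : dotv (grad g x) (xp - xbar) =
    dotv (grad g x) (xp - x) - dotv (grad g x) (xbar - x).
  by rewrite -dotvNr -dotvDr opprB addrA subrK.
lra.
Qed.

End Subproblem.

(** * Arithmetic behind [zeta] *)

Section MultiplierArithmetic.
Context {R : realType}.
Implicit Types N J D E b S Lh : R.

(* The last hypothesis holds once some constraint is active; it forces the factor
   of N * (1 + Lh) to be at least 8, which absorbs the 1 in 1 + S. *)
Lemma multiplier_arith N J D E b S Lh : 0 < N -> 1 <= J -> 0 <= D -> 0 <= E ->
  0 <= Lh -> 0 < b -> 0 <= S ->
  let A := b + N / 2 * (E + D) ^+ 2 in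
  S * (b ^+ 2 / (4 * A)) <=
    (J + 2 * N * D + Lh) * (2 * D + E / 2) + N / 2 * ((E + D) / 2) ^+ 2 ->
  b <= (J + 2 * N * D) * (D + E) + 2 * N * D ^+ 2 ->
  N * (1 + S) <=
    8 * N * (J / N + 1 / 2 * (11 * D + E)) ^+ 2 * (A / b ^+ 2) * (N * (1 + Lh)).
Proof.
move=> N0 J1 D0 E0 Lh0 b0 S0 A hS hb.
have A0 : 0 < A.
  by rewrite ltr_wpDr// mulr_ge0 ?divr_ge0 ?sqr_ge0// ltW.
(* Expanding the square in the target gives [N * (1 + Lh) * c] times [2 * Q] plus nonnegative terms:
   one [Q] bounds [S], the other absorbs the 1. *)
pose P := (11 * D + E) / 2; pose Q := J * P + N * P ^+ 2.
pose c := 4 * A / b ^+ 2.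
have c0 : 0 < c by rewrite divr_gt0 ?mulr_gt0 ?exprn_gt0.
have P0 : 0 <= P by rewrite /P; lra.
have ND0 : 0 <= N * D by rewrite mulr_ge0// ltW.
have NE0 : 0 <= N * E by rewrite mulr_ge0// ltW.
have DD : 0 <= N * D * D by rewrite mulr_ge0.
have DE : 0 <= N * D * E by rewrite mulr_ge0.
have EE : 0 <= N * E * E by rewrite mulr_ge0.
have JD : 0 <= J * D by rewrite mulr_ge0//; lra.
have JE : 0 <= J * E by rewrite mulr_ge0//; lra.
have Q0 : 0 <= Q by rewrite /Q addr_ge0 ?mulr_ge0 ?sqr_ge0//; lra.
have bQ : b <= 2 * Q by apply: le_trans hb _; rewrite /Q /P; lra.
have SQ : S <= (1 + Lh) * c * Q.
  have -> : (1 + Lh) * c * Q = (1 + Lh) * Q / (b ^+ 2 / (4 * A)).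
    by rewrite /c; field; rewrite !lt0r_neq0.
  rewrite ler_pdivlMr ?divr_gt0 ?mulr_gt0 ?exprn_gt0//.
  apply: le_trans hS _.
  (* Here [1 <= J] turns a bare distance into a term of [Q]. *)
  have LP : Lh * (2 * D + E / 2) <= Lh * (J * P).
    rewrite ler_wpM2l// (@le_trans _ _ P)//; first by rewrite /P; lra.
    by rewrite ler_peMl.
  have LN : 0 <= Lh * (N * P ^+ 2).
    by apply: mulr_ge0 => //; exact: mulr_ge0 (ltW N0) (sqr_ge0 _).
  have : (J + 2 * N * D) * (2 * D + E / 2) + N / 2 * ((E + D) / 2) ^+ 2 <= Q.
    by rewrite /Q /P; lra.
  have : Lh * (2 * D + E / 2) <= Lh * Q by rewrite /Q; lra.
  lra.
(* Since [b <= A], [c * b] is at least 4; with [bQ] this gives [2 <= c * Q]. *)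
have cb : 1 <= c * b / 4.
  have -> : c * b / 4 = A / b by rewrite /c; field; rewrite lt0r_neq0.
  rewrite ler_pdivlMr// mul1r /A lerDl.
  by rewrite mulr_ge0 ?divr_ge0 ?sqr_ge0// ltW.
have cQ : 2 <= c * Q.
  have : c * b <= c * (2 * Q) by rewrite ler_pM2l.
  lra.
have -> : 8 * N * (J / N + 1 / 2 * (11 * D + E)) ^+ 2 * (A / b ^+ 2) *
    (N * (1 + Lh)) =
    N * ((1 + Lh) * (c * (2 * (J ^+ 2 / N) + 2 * Q + 2 * (J * P)))).
  rewrite /c /Q /P; field; by rewrite !lt0r_neq0.
rewrite ler_pM2l//.
have : (1 + Lh) * (c * (2 * Q)) <=
  (1 + Lh) * (c * (2 * (J ^+ 2 / N) + 2 * Q + 2 * (J * P))).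
  have JN : 0 <= J ^+ 2 / N by rewrite divr_ge0 ?sqr_ge0// ltW.
  have JP : 0 <= J * P by rewrite mulr_ge0//; lra.
  by rewrite ler_wpM2l ?addr_ge0// ler_pM2l//; lra.
have : 0 <= Lh * (c * Q) by apply: mulr_ge0 => //; exact: mulr_ge0 (ltW c0) Q0.
lra.
Qed.

End MultiplierArithmetic.

(** * Uniform multiplier bound and telescoping along the iterates *)

Section Iteration.
Context {R : realType} {n m : nat}.
Context (f h : 'rV[R]_n -> R) (fs : 'I_m -> 'rV[R]_n -> R).
Context (Lf Lh : R) (Ls : 'I_m -> R) (x0 xbar xstar : 'rV[R]_n) (N J b : R).
Context (f_convex : convexfun f) (f_diff : forall z, differentiable f z)
  (Lf_ge0 : 0 <= Lf) (f_lip : elipschitz Lf (grad f)).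
Context (fs_convex : forall i, convexfun (fs i))
  (fs_diff : forall i z, differentiable (fs i) z)
  (Ls_ge0 : forall i, 0 <= Ls i)
  (fs_lip : forall i, elipschitz (Ls i) (grad (fs i))).
Context (h_convex : convexfun h) (Lh_ge0 : 0 <= Lh) (h_lip : elipschitzR Lh h).
Context (xstar_sol : argmin (feasible fs) (fun z => f z + h z) xstar).
Context (N_gt0 : 0 < N) (Lf_le : Lf <= N) (Ls_le : forall i, Ls i <= N).
Context (J_ge1 : 1 <= J) (f_J : enorm (grad f x0) <= J)
  (fs_J : forall i, enorm (grad (fs i) x0) <= J).
Context (b_gt0 : 0 < b) (slater : forall i, fs i xbar <= - b).

Notation D := (enorm (x0 - xstar)).
Notation E := (enorm (xbar - xstar)).
Notation A := (b + N / 2 * (E + D) ^+ 2).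
Notation G := (fun z => f z + h z).
Notation M := (Num.max 1 (zeta N J b x0 xstar xbar) * (N * (1 + Lh))).

Lemma subproblem_feasible x xp :
  subproblem_sol f h Lf fs Ls x xp -> feasible fs xp.
Proof.
move=> [xpf _] i; apply: le_trans (xpf i).
exact: quad_model_ge (fs_convex i) (fs_diff i) (Ls_ge0 i) (fs_lip i).
Qed.

(** The models agree with their functions at [x], so [x] competes in its own subproblem, while the
    model of [f] majorises [f] at [xp]. *)
Lemma subproblem_monotone x xp : feasible fs x ->
  subproblem_sol f h Lf fs Ls x xp -> G xp <= G x.
Proof.
have q0 g L : quad_model g L x x = g x.
  by rewrite /quad_model subrr enorm0 -(scale0r 0) dotvZr; ring.
move=> xf [_ /(_ x)]; rewrite q0 => H; apply: le_trans (H _) => [|i].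
  by rewrite lerD2r quad_model_ge.
by rewrite q0.
Qed.

(** Both [x] and [x0] lie within [D] of [xstar], hence within [2 * D] of each other. *)
Lemma grad_bound g L x : elipschitz L (grad g) -> 0 <= L -> L <= N ->
  enorm (grad g x0) <= J -> enorm (x - xstar) <= D ->
  enorm (grad g x) <= J + 2 * N * D.
Proof.
move=> lipg L0 LN gJ xD.
have := enormD (grad g x0) (grad g x - grad g x0); rewrite addrC subrK.
have := lipg x x0.
have : L * enorm (x - x0) <= N * (D + D).
  apply: ler_pM; rewrite ?enorm_ge0//.
  apply: le_trans (enormB_le _ xstar _) _.
  by rewrite (enormBC xstar) lerD2r.
lra.
Qed.

(** The point lies at the fraction [b / (2 * A)] of the way from [x] to [xbar]; as [b <= A] this is
    at most 1/2, whence the halves. It yields existence of multipliers and, through its margin,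
    their size. *)
Lemma subproblem_slater x : feasible fs x -> enorm (x - xstar) <= D ->
  exists y, [/\ enorm (y - x) <= (E + D) / 2, enorm (y - xstar) <= D + E / 2 &
    forall i, quad_model (fs i) (Ls i) x y <= - (b ^+ 2 / (4 * A))].
Proof.
move=> xf xD.
have D0 : 0 <= D := enorm_ge0 _.
have E0 : 0 <= E := enorm_ge0 _.
have NW : 0 <= N / 2 * (E + D) ^+ 2.
  by apply: mulr_ge0 (sqr_ge0 _); have := N_gt0; lra.
have A0 : 0 < A by have := b_gt0; lra.
set t := b / (2 * A).
have t0 : 0 <= t by rewrite divr_ge0 ?mulr_ge0 ?ltW.
have t1 : t <= 1 / 2.
  by rewrite ler_pdivrMr ?mulr_gt0//; have := b_gt0; lra.
have xW : enorm (xbar - x) <= E + D.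
  by apply: le_trans (enormB_le _ xstar _) _; rewrite (enormBC xstar) lerD2l.
exists (x + t *: (xbar - x)); split => [||i].
- rewrite addrC addKr ?addrK enormZ ger0_norm//.
  apply: (@le_trans _ _ (1 / 2 * (E + D))); last by lra.
  by apply: ler_pM; rewrite ?enorm_ge0.
- rewrite (_ : _ - xstar = (1 - t) *: (x - xstar) + t *: (xbar - xstar)).
    apply: le_trans (enormD _ _) _.
    rewrite !enormZ !ger0_norm ?subr_ge0//; last by lra.
    have : (1 - t) * enorm (x - xstar) <= 1 * D.
      by apply: ler_pM; rewrite ?enorm_ge0//; lra.
    have : t * E <= 1 / 2 * E by rewrite ler_wpM2r.
    lra.
  by apply/rowP => j; rewrite !mxE; ring.
- exact: (@quad_model_slater _ _ (fs i) (Ls i) N).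
Qed.

(** [x] and [xp] stay within [D] of [xstar], which makes the bound independent of the iteration. *)
Lemma multiplier_bound x xp (lam : 'I_m -> R) :
  feasible fs x -> enorm (x - xstar) <= D -> enorm (xp - xstar) <= D ->
  (forall i, 0 <= lam i) ->
  (forall i, lam i * quad_model (fs i) (Ls i) x xp = 0) ->
  (forall y, quad_model f Lf x xp + h xp +
      (Lf + \sum_i lam i * Ls i) / 2 * enorm (y - xp) ^+ 2 <=
    quad_model f Lf x y + h y + \sum_i lam i * quad_model (fs i) (Ls i) x y) ->
  Lf + \sum_i lam i * Ls i <= M.
Proof.
move=> xf xD xpD lam0 slack lamP.
have D0 : 0 <= D := enorm_ge0 _.
have E0 : 0 <= E := enorm_ge0 _.
have NL : N <= N * (1 + Lh).
  by rewrite ler_peMr ?(ltW N_gt0)//; have := Lh_ge0; lra.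
have NL0 : 0 <= N * (1 + Lh) by apply: le_trans NL; exact: ltW.
(* If all multipliers vanish the modulus is [Lf], covered by the 1 in the maximum; otherwise some
   constraint is active and [zeta] takes over. *)
have [lam_eq0|] := pselect (forall i, lam i = 0).
  rewrite big1 => [|i _]; last by rewrite lam_eq0 mul0r.
  rewrite addr0; apply: le_trans (le_trans Lf_le NL) _.
  by rewrite ler_peMl// le_max lexx.
move=> /existsNP[i /eqP lami].
have xpx : enorm (xp - x) <= 2 * D.
  apply: le_trans (enormB_le _ xstar _) _; rewrite (enormBC xstar).
  by rewrite mulr_natl mulr2n lerD.
have gJ k :=
  @grad_bound _ _ x (fs_lip k) (Ls_ge0 k) (Ls_le k) (fs_J k) xD.
have JD0 : 0 <= J + 2 * N * D by apply: le_trans (gJ i); exact: enorm_ge0.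
have ub_b : b <= (J + 2 * N * D) * (D + E) + 2 * N * D ^+ 2.
  have qi : quad_model (fs i) (Ls i) x xp = 0.
    by apply/eqP; have /eqP := slack i; rewrite mulf_eq0 (negPf lami).
  have h1 := active_slater_bound xbar (fs_convex i) (fs_diff i x) qi.
  have h2 : enorm (grad (fs i) x) * enorm (xp - xbar) <=
      (J + 2 * N * D) * (D + E).
    apply: ler_pM; rewrite ?enorm_ge0//.
    by apply: le_trans (enormB_le _ xstar _) _; rewrite (enormBC xstar) lerD2r.
  have h3 : Ls i / 2 * enorm (xp - x) ^+ 2 <= N / 2 * (2 * D) ^+ 2.
    apply: ler_pM; rewrite ?sqr_ge0 ?divr_ge0//.
      by rewrite ler_pM2r ?invr_gt0.
    by rewrite ler_sqr ?nnegrE ?enorm_ge0 ?mulr_ge0.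
  have := slater i; lra.
set S := \sum_i lam i.
have S0 : 0 <= S by exact: sumr_ge0.
have LS : Lf + \sum_i lam i * Ls i <= N * (1 + S).
  rewrite mulrDr mulr1 lerD// mulrC mulr_suml; apply: ler_sum => k _.
  by rewrite ler_wpM2l.
have [y [yx yxstar yq]] := subproblem_slater xf xD.
have yxp : enorm (y - xp) <= 2 * D + E / 2.
  by have := enormB_le y xstar xp; rewrite (enormBC xstar); lra.
(* The Lagrangian inequality at [y]: the sum of multipliers times the margin is at most the growth
   of the objective model from [xp] to [y]. The nonnegative terms [h5] and [h6] are dropped. *)
have Sb : S * (b ^+ 2 / (4 * A)) <=
    (J + 2 * N * D + Lh) * (2 * D + E / 2) + N / 2 * ((E + D) / 2) ^+ 2.
  have h1 : \sum_i lam i * quad_model (fs i) (Ls i) x y <=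
      - (S * (b ^+ 2 / (4 * A))).
    by rewrite -mulrN mulr_suml; apply: ler_sum => k _; rewrite ler_wpM2l.
  have h2 : dotv (grad f x) (y - xp) <= (J + 2 * N * D) * (2 * D + E / 2).
    apply: le_trans (dotv_le _ _) _; apply: ler_pM; rewrite ?enorm_ge0//.
    exact: (grad_bound f_lip).
  have h3 : h y - h xp <= Lh * (2 * D + E / 2).
    apply: le_trans (ler_norm _) _; apply: le_trans (h_lip _ _) _.
    by rewrite ler_wpM2l.
  have h4 : Lf / 2 * enorm (y - x) ^+ 2 <= N / 2 * ((E + D) / 2) ^+ 2.
    apply: ler_pM; rewrite ?sqr_ge0 ?divr_ge0//.
      by rewrite ler_pM2r ?invr_gt0.
    by rewrite ler_sqr ?nnegrE ?enorm_ge0 ?divr_ge0 ?addr_ge0.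
  have h5 : 0 <= Lf / 2 * enorm (xp - x) ^+ 2.
    by rewrite mulr_ge0 ?sqr_ge0 ?divr_ge0.
  have h6 : 0 <= (Lf + \sum_i lam i * Ls i) / 2 * enorm (y - xp) ^+ 2.
    rewrite mulr_ge0 ?sqr_ge0 ?divr_ge0 ?addr_ge0//.
    by apply: sumr_ge0 => k _; rewrite mulr_ge0.
  have h7 : dotv (grad f x) (y - xp) =
      dotv (grad f x) (y - x) - dotv (grad f x) (xp - x).
    by rewrite -dotvNr -dotvDr opprB addrA subrK.
  have := lamP y; rewrite /quad_model; rewrite /quad_model in h1; lra.
apply: le_trans LS _.
apply: le_trans (multiplier_arith N_gt0 J_ge1 D0 E0 Lh_ge0 b_gt0 S0 Sb ub_b) _.
rewrite ler_wpM2r// le_max; apply/orP; right.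
rewrite /zeta le_eqVlt; apply/orP; left; apply/eqP.
by rewrite (enormBC xstar xbar) (enormBC xstar x0).
Qed.

(** Strict suboptimality of [xp] makes the difference of squared distances positive. So [xp] stays
    in the ball where [multiplier_bound] holds, and the modulus may be replaced by its bound. *)
Lemma subproblem_progress x xp : feasible fs x -> enorm (x - xstar) <= D ->
  subproblem_sol f h Lf fs Ls x xp -> G xstar < G xp ->
  enorm (xp - xstar) <= D /\
  G xp - G xstar <= M / 2 * (enorm (x - xstar) ^+ 2 - enorm (xp - xstar) ^+ 2).
Proof.
move=> xf xD sub Glt.
have [y [_ _ yq]] := subproblem_slater xf xD.
have A0 : 0 < A.
  rewrite ltr_wpDr//; apply: mulr_ge0 (sqr_ge0 _).
  by have := N_gt0; lra.
have yq0 i : quad_model (fs i) (Ls i) x y < 0.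
  by apply: le_lt_trans (yq i) _; rewrite oppr_lt0 divr_gt0 ?exprn_gt0 ?mulr_gt0.
have [lam [lam0 slack lamP]] :=
  subproblem_multipliers Lf_ge0 Ls_ge0 h_convex yq0 sub.
have := subproblem_decrease f_convex f_diff Lf_ge0 f_lip fs_convex fs_diff
  lam0 lamP xstar_sol.1.
set Lam := Lf + _ => dec.
have Lam0 : 0 <= Lam.
  by rewrite addr_ge0//; apply: sumr_ge0 => i _; rewrite mulr_ge0.
have dgt0 : 0 < enorm (x - xstar) ^+ 2 - enorm (xp - xstar) ^+ 2.
  rewrite ltNge; apply/negP => d0; move: Glt; apply/negP.
  rewrite -leNgt -subr_le0.
  by apply: le_trans dec _; rewrite mulr_ge0_le0// divr_ge0.
have xpx : enorm (xp - xstar) <= enorm (x - xstar).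
  by rewrite -ler_sqr ?nnegrE ?enorm_ge0// -subr_ge0 ltW.
have xpD := le_trans xpx xD.
split=> //; apply: le_trans dec _; rewrite ler_wpM2r ?(ltW dgt0)//.
rewrite ler_wpM2r ?invr_ge0//; exact: multiplier_bound lamP.
Qed.

(** Once the optimal value is reached, monotonicity keeps it. Until then the one-step estimates
    telescope, and monotonicity replaces each earlier value by the last one. *)
Lemma iteration_rate (x : nat -> 'rV[R]_n) k : x 0%N = x0 ->
  feasible fs x0 ->
  (forall k, subproblem_sol f h Lf fs Ls (x k) (x k.+1)) ->
  feasible fs (x k) /\ (G (x k) <= G xstar \/
    enorm (x k - xstar) <= D /\
    k%:R * (G (x k) - G xstar) <= M / 2 * (D ^+ 2 - enorm (x k - xstar) ^+ 2)).
Proof.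
move=> xx0 x0f sub; elim: k => [|k [xkf IH]].
  by rewrite xx0; split=> //; right; rewrite mul0r subrr mulr0.
split; first exact: subproblem_feasible (sub k).
have mono := subproblem_monotone xkf (sub k).
have [le_opt|gt_opt] := leP (G (x k.+1)) (G xstar); first by left.
case: IH => [le_opt|[xkD IH]].
  by have := le_trans mono le_opt; rewrite leNgt gt_opt.
right; have [xpD dec] := subproblem_progress xkf xkD (sub k) gt_opt.
split=> //; rewrite -natr1 mulrDl mul1r.
have : k%:R * (G (x k.+1) - G xstar) <= k%:R * (G (x k) - G xstar).
  by rewrite ler_wpM2l// lerD2r.
lra.
Qed.

End Iteration.

Theorem corollary4 (R : realType) (n m : nat)
    (f h : 'rV[R]_n -> R) (fs : 'I_m -> 'rV[R]_n -> R)
    (Lf Lh : R) (Ls : 'I_m -> R)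
    (xbar xstar : 'rV[R]_n) (x : nat -> 'rV[R]_n) (i0 : 'I_m)
    (f_convex : convexfun f)
    (f_diff : forall z, differentiable f z)
    (f_lip : elipschitz Lf (grad f))
    (fs_convex : forall i, convexfun (fs i))
    (fs_diff : forall i z, differentiable (fs i) z)
    (fs_C1 : forall i, continuous (grad (fs i)))
    (Ls_ge0 : forall i, 0 <= Ls i)
    (fs_lip : forall i, elipschitz (Ls i) (grad (fs i)))
    (h_convex : convexfun h)
    (h_lip : elipschitzR Lh h)
    (slater : forall i, fs i xbar < 0)
    (xstar_sol : argmin (feasible fs) (fun z => f z + h z) xstar)
    (Ls_gt0 : 0 < Ls i0)
    (x0_feasible : feasible fs (x 0%N))
    (x_step : forall k, subproblem_sol f h Lf fs Ls (x k) (x k.+1))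
    (x_stop : forall k, subproblem_sol f h Lf fs Ls (x k) (x k) ->
                        x k.+1 = x k) :
  let normL := enorm (stackL n Lf Ls) in
  let fbar := `|\big[Num.max/fs i0 xbar]_(i < m) fs i xbar| in
  let z := zeta normL (opnorm ('J (stackF f fs) (x 0%N))) fbar
             (x 0%N) xstar xbar in
  forall k, (1 <= k)%N ->
    feasible fs (x k) /\
    (f (x k) + h (x k)) - (f xstar + h xstar)
      <= Num.max 1 z *
         (normL * (1 + Lh) * enorm (x 0%N - xstar) ^+ 2 / (2 * k%:R)).
Proof.
move=> normL fbar z k k1.
(* In dimension 0 all points coincide; a positive dimension supplies the unit vector used below for
   the signs of [Lf] and [Lh]. *)
have [n0|n0] := posnP n.
  have eqstar (y : 'rV[R]_n) : y = xstar.
    by apply/rowP => j; have := ltn_ord j; rewrite {2}n0.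
  split; first by rewrite (eqstar (x k)); exact: xstar_sol.1.
  rewrite (eqstar (x k)) (eqstar (x 0%N)) !subrr.
  by rewrite enorm0 expr0n/= mulr0 mul0r mulr0.
have [Lf_le Ls_le] := coord_le_enorm_stackL (n := n) Lf Ls.
have normL_gt0 : 0 < normL.
  by apply: lt_le_trans Ls_gt0 _; apply: le_trans (Ls_le i0); exact: ler_norm.
pose e : 'rV[R]_n := delta_mx 0 (Ordinal n0).
have e0 : 0 < enorm (e - 0).
  rewrite subr0 lt_def enorm_ge0 andbT; apply/eqP => /enorm_eq0.
  move=> /rowP/(_ (Ordinal n0)).
  by rewrite !mxE !eqxx => /eqP; rewrite oner_eq0.
have Lf_ge0 : 0 <= Lf.
  by rewrite -(pmulr_lge0 _ e0); apply: le_trans (f_lip e 0); exact: enorm_ge0.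
have Lh_ge0 : 0 <= Lh.
  by rewrite -(pmulr_lge0 _ e0); apply: le_trans (h_lip e 0).
have dF : differentiable (stackF f fs) (x 0%N) by exact: differentiable_stackF.
(* The default [fs i0 xbar] is one of the values, so it does not alter the maximum. *)
have max_lt0 : \big[Num.max/fs i0 xbar]_(i < m) fs i xbar < 0.
  by apply: bigmax_lt => // i _; exact: slater.
have fbarE : fbar = - \big[Num.max/fs i0 xbar]_(i < m) fs i xbar.
  by rewrite /fbar ltr0_norm.
have fbar_gt0 : 0 < fbar by rewrite fbarE oppr_gt0.
have fs_fbar i : fs i xbar <= - fbar.
  by rewrite fbarE opprK; exact: le_bigmax.
have f_J : enorm (grad f (x 0%N)) <= opnorm ('J (stackF f fs) (x 0%N)).
  have := grad_coord_le_opnorm (lshift n (lshift m 0)) dF.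
  by under [X in grad X]eq_fun do rewrite stackF_obj.
have fs_J i : enorm (grad (fs i) (x 0%N)) <= opnorm ('J (stackF f fs) (x 0%N)).
  have := grad_coord_le_opnorm (lshift n (rshift 1 i)) dF.
  by under [X in grad X]eq_fun do rewrite stackF_constr.
have := @iteration_rate _ _ _ f h fs Lf Lh Ls (x 0%N) xbar xstar normL
  (opnorm ('J (stackF f fs) (x 0%N))) fbar f_convex f_diff Lf_ge0 f_lip
  fs_convex fs_diff Ls_ge0 fs_lip h_convex Lh_ge0 h_lip xstar_sol normL_gt0
  (le_trans (ler_norm _) Lf_le) (fun i => le_trans (ler_norm _) (Ls_le i))
  (opnorm_stackF_ge1 n0 dF) f_J fs_J fbar_gt0 fs_fbar x k erefl x0_feasible
  x_step.
rewrite -/z => -[xkf rate]; split=> //.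
have k0 : 0 < k%:R :> R by rewrite ltr0n.
have max_ge0 : 0 <= Num.max 1 z by rewrite le_max ler01.
have C0 : 0 <= Num.max 1 z * (normL * (1 + Lh)).
  by rewrite !mulr_ge0 ?enorm_ge0//; lra.
set C := Num.max 1 z * (normL * (1 + Lh)) in rate C0 *.
have -> : Num.max 1 z * (normL * (1 + Lh) * enorm (x 0%N - xstar) ^+ 2 /
    (2 * k%:R)) = C / 2 * enorm (x 0%N - xstar) ^+ 2 / k%:R.
  by rewrite /C; field; exact: lt0r_neq0.
rewrite ler_pdivlMr// mulrC.
(* At the optimal value the left side is nonpositive; otherwise the remaining squared distance is
   dropped. *)
case: rate => [le_opt|[_ rate]].
  apply: (@le_trans _ _ 0); last by rewrite mulr_ge0 ?sqr_ge0 ?divr_ge0.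
  by rewrite mulr_ge0_le0 ?subr_le0// ltW.
apply: le_trans rate _; rewrite ler_wpM2l ?divr_ge0// gerDl oppr_le0.
exact: sqr_ge0.
Qed.
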